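(* Let $|\mu\rangle,|\bar\mu\rangle\in\mathbb{C}^2\otimes\mathbb{C}^2$ be two-qubit states with squared Schmidt coefficients $\left(\frac{1}{1+a},\frac{a}{1+a}\right)$ and $\left(\frac{1}{1+\bar a},\frac{\bar a}{1+\bar a}\right)$ respectively, where $a,\bar a\in(0,1)$ and $a>\bar a$. Let $d\ge 3$ be odd. The following are equivalent: (i) there exist states $|\lambda\rangle,|\bar\lambda\rangle\in\mathbb{C}^d\otimes\mathbb{C}^d$ of full Schmidt rank $d$ such that $|\mu\rangle\otimes|\lambda\rangle$ can be transformed into $|\bar\mu\rangle\otimes|\bar\lambda\rangle$ by a local unitary; (ii) $\bar a=a^{d_1/d_2}$ for two odd natural numbers $d_1,d_2$ with $d\ge d_1>d_2\ge 1$.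
   Context: The state $|\mu\rangle\otimes|\lambda\rangle$ is regarded as a bipartite state between two parties, each holding a $2$-dimensional and a $d$-dimensional subsystem. A local unitary is $U_A\otimes U_B$ with $U_A,U_B\in\mathrm{U}(2d)$, each acting jointly on the corresponding party's two subsystems. *)

(* Defs.v *)
From HB Require Import structures.
From mathcomp Require Import all_boot all_order all_algebra.
From mathcomp Require Import reals exp.
From mathcomp Require Import complex mxtens.
Set Implicit Arguments. Unset Strict Implicit. Unset Printing Implicit Defensive.
Import Order.TTheory GRing.Theory Num.Theory.
Local Open Scope ring_scope.
Local Open Scope complex_scope.

(* A pure state of C^m (x) C^n is represented by its coefficient matrix
   M : 'M_(m,n), |psi> = sum_{i,j} M i j |i>|j>. *)

(* conjugate transpose *)
Definition adjmx (R : rcfType) m n (M : 'M[R[i]]_(m, n)) : 'M[R[i]]_(n, m) :=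
  map_mx conjc M^T.

(* normalization: <psi|psi> = 1 *)
Definition is_state (R : rcfType) m n (M : 'M[R[i]]_(m, n)) : Prop :=
  \sum_i \sum_j (M i j * (M i j)^*) = 1.

Definition unitary (R : rcfType) n (U : 'M[R[i]]_n) : Prop :=
  U *m adjmx U = 1%:M.

(* the squared Schmidt coefficients of the two-qubit state M are p and q,
   i.e. the eigenvalues (with multiplicity) of the reduced density matrix
   M M^dagger are p and q *)
Definition sq_schmidt_coeffs2 (R : rcfType) (M : 'M[R[i]]_2) (p q : R) : Prop :=
  char_poly (M *m adjmx M) = ('X - (p%:C)%:P) * ('X - (q%:C)%:P).

(* Schmidt rank = rank of the coefficient matrix *)
Definition schmidt_rank (R : rcfType) m n (M : 'M[R[i]]_(m, n)) : nat := \rank M.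

(* |mu>(x)|lam>, regrouped as a bipartite state on (C^m(x)C^p) (x) (C^n(x)C^q):
   coefficient matrix is the Kronecker product *)
Definition tens_state (R : rcfType) m n p q (mu : 'M[R[i]]_(m, n)) (lam : 'M[R[i]]_(p, q))
  : 'M[R[i]]_(m * p, n * q) := mu *t lam.

(* (U_A (x) U_B)|psi> has coefficient matrix U_A M U_B^T *)
Definition local_unitary_maps (R : rcfType) N (psi phi : 'M[R[i]]_N) : Prop :=
  exists UA UB : 'M[R[i]]_N, unitary UA /\ unitary UB /\ UA *m psi *m UB^T = phi.

(* Main.v *)
(* The squared Schmidt coefficients of a tensor product are the products of
   those of the factors, and local unitary equivalence means equality of the
   multisets of squared Schmidt coefficients. With logarithms in units of [ln ab],
   so that [ab] becomes 1 and [a] becomes [alpha] in (0, 1), and after shifting to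
   absorb the normalizations, (i) asks for real multisets L, Lb of size d such that
   L + (L + alpha) = Lb + (Lb + 1).

   (i) => (ii): F t, the sum of (-1) ^ (x - t) over the x in L with x - t an
   integer, changes sign under t -> t - 1 and, by the multiset equation, under
   t -> t - alpha. As d is odd, some class modulo 1 has odd multiplicity in L, so
   F t <> 0 for some t; hence each t - k alpha is congruent modulo 1 to an element
   of L, and by pigeonhole n alpha = m is an integer for a least 0 < n <= d. The
   sign changes give n = m modulo 2, and minimality of n excludes that both are
   even.

   (ii) => (i): with x = a ^ (1 / d2), one needs polynomials L, Lb with natural
   coefficients, of value d at 1, such that (1 + x^d2) L = (1 + x^d1) Lb. One
   solution has value d1 at 1; the trivial solution L = 1 + x^d1, Lb = 1 + x^d2
   is added to it (d - d1) / 2 times. *)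
Require Import Defs.
From HB Require Import structures.
From mathcomp Require Import all_boot all_order all_algebra all_fingroup.
From mathcomp Require Import archimedean sesquilinear spectral.
From mathcomp Require Import reals exp.
From mathcomp Require Import complex mxtens.
From mathcomp Require Import ring lra zify.
Import Order.TTheory GRing.Theory Num.Theory.
Local Open Scope ring_scope.

Set Implicit Arguments.
Unset Strict Implicit.
Unset Printing Implicit Defensive.

(** * Alternating sums over classes modulo 1 *)

Lemma odd_size_class (T : eqType) (e : rel T) (s : seq T) :
  equivalence_rel e -> odd (size s) -> exists t, odd (count (e t) s).
Proof.
move=> eqe; have [n] := ubnP (size s); elim: n s => // n IHn [|x s] // lt_s.
have exx : e x x by have [] := eqe x x x.
(* Remove the class of [x]: if it is even, the rest [s'] has odd size, and induction gives a class
   that is odd in [s']. That class is not the one of [x], which misses [s'], so it is complete in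
   [s']. *)
set s' := filter (predC (e x)) (x :: s).
have sz : size (x :: s) = (count (e x) (x :: s) + size s')%N.
  by rewrite size_filter count_predC.
have lt_s' : (size s' < n)%N.
  by rewrite /s' /= exx size_filter; apply: leq_ltn_trans (count_size _ _) _.
rewrite sz oddD; case: (boolP (odd (count _ _))) => [?|_ /=]; first by exists x.
case/(IHn _ lt_s') => t; rewrite count_filter => odd_t; exists t; move: odd_t.
have [ext|next] := boolP (e x t).
  rewrite (@eq_count _ _ pred0) ?count_pred0 // => y /=.
  by have [_ ->] := eqe x t y; rewrite // andbN.
rewrite (@eq_count _ _ (e t)) // => y /=; apply: andb_idr => ety.
apply: contra next => exy; have [_ h1] := eqe x y t; rewrite h1 //.
by have [ett h2] := eqe t y t; rewrite -h2.
Qed.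

Section IntSign.
Variable R : archiRealFieldType.

(** Extending the sign character of the integers by zero lets a sum over a whole sequence see only
    one class modulo 1. *)
Definition int_sign (z : R) : R :=
  if z \is a Num.int then (-1) ^ Num.floor z else 0.

Lemma int_signD z m : int_sign (z + m%:R) = (-1) ^+ m * int_sign z.
Proof.
have mZ : (m%:R : R) \is a Num.int by apply: rpred_nat.
rewrite /int_sign; have -> : (z + m%:R \is a Num.int) = (z \is a Num.int).
  by rewrite rpredDr.
case: ifP; last by rewrite mulr0.
have -> : (m%:R : R) = (m%:Z)%:~R by [].
by rewrite floorDrz // intrKfloor exprzDr ?unitrN ?unitr1 // mulrC.
Qed.

(** Each odd integer contributes -1 = 1 - 2, so the alternating sum has the parity of the count; an
    odd count forces it to be nonzero. *)
Lemma sum_int_sign (s : seq R) :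
  exists j : nat, \sum_(z <- s) int_sign z =
    (count (fun z => z \is a Num.int) s)%:R - (2 * j)%:R.
Proof.
elim: s => [|z s [j IH]]; first by exists 0%N; rewrite big_nil subrr.
rewrite big_cons IH /= {1}/int_sign; case: ifP => _; last first.
  by exists j; rewrite add0r.
have [->|->] : (-1 : R) ^ Num.floor z = 1 \/ (-1 : R) ^ Num.floor z = -1.
- case: (Num.floor z) => n; rewrite /exprz -signr_odd; case: odd;
    rewrite ?expr0 ?expr1 ?invr1 ?invrN1; tauto.
- by exists j; rewrite natrD addrA.
- by exists j.+1; rewrite mulnS !natrD /=; lra.
Qed.

Lemma odd_ratio_of_perm (alpha : R) (L Lb : seq R) :
  0 < alpha < 1 -> odd (size L) ->
  perm_eq (L ++ [seq x + alpha | x <- L]) (Lb ++ [seq x + 1 | x <- Lb]) ->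
  exists n m : nat, [/\ odd n, odd m, (1 <= m < n)%N, (n <= size L)%N &
    n%:R * alpha = m%:R].
Proof.
move=> /andP[a0 a1] oddL pL.
pose F t := \sum_(x <- L) int_sign (x - t).
(* On the [Lb] side the terms of [x] and [x + 1] cancel, so [F t + F (t - alpha)], which is the sum
   on the [L] side, vanishes. *)
have F_alpha t : F (t - alpha) = - F t.
  have : \sum_(x <- L ++ [seq x + alpha | x <- L]) int_sign (x - t) =
         \sum_(x <- Lb ++ [seq x + 1 | x <- Lb]) int_sign (x - t).
    exact: perm_big.
  rewrite !big_cat !big_map /= => E; apply/eqP; rewrite -addr_eq0; apply/eqP.
  transitivity (\sum_(x <- Lb) int_sign (x - t)
                + \sum_(x <- Lb) int_sign (x + 1 - t)).
    rewrite -E addrC; congr (_ + _); apply: eq_bigr => x _; congr int_sign; ring.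
  rewrite -big_split big1 //= => x _.
  have -> : x + 1 - t = x - t + 1%:R by ring.
  by rewrite int_signD expr1; ring.
have F_natalpha k t : F (t - k%:R * alpha) = (-1) ^+ k * F t.
  elim: k => [|k IHk]; first by rewrite mul0r subr0 mul1r.
  have -> : t - k.+1%:R * alpha = t - k%:R * alpha - alpha by rewrite -natr1; ring.
  by rewrite F_alpha IHk exprS mulN1r mulNr.
have F_nat m t : F (t - m%:R) = (-1) ^+ m * F t.
  rewrite /F mulr_sumr; apply: eq_bigr => x _; rewrite -int_signD.
  by congr int_sign; ring.
have eqZ : equivalence_rel (fun t x : R => x - t \is a Num.int).
  move=> x y z; split=> [|xy]; first by rewrite subrr rpred0.
  have -> : z - x = z - y + (y - x) by ring.
  by rewrite rpredDr.
have [t Ft] : exists t, F t != 0.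
  have [t oddt] := odd_size_class eqZ oddL; exists t.
  have [j] := sum_int_sign [seq x - t | x <- L].
  rewrite big_map -/(F t) => ->; rewrite count_map subr_eq0 eqr_nat.
  by apply: contraL oddt => /eqP ->; rewrite oddM.
have hit (k : 'I_(size L).+1) :
    exists i : 'I_(size L), L`_i - t + k%:R * alpha \is a Num.int.
  have Fk : F (t - k%:R * alpha) != 0.
    by rewrite F_natalpha mulf_neq0 // expf_neq0 // oppr_eq0 oner_eq0.
  have /hasP[x xL xZ] : has (fun x => x - t + k%:R * alpha \is a Num.int) L.
    apply: contraR Fk => /hasPn noL; rewrite /F big_seq big1 // => x /noL.
    rewrite /int_sign; have -> : x - (t - k%:R * alpha) = x - t + k%:R * alpha by ring.
    by move=> /negPf ->.
  move: xL; rewrite -index_mem => ltx; exists (Ordinal ltx) => /=.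
  by rewrite nth_index // -index_mem.
have [n0 /andP[n0_gt0 n0Z] n0_le] :
    exists2 n, (0 < n)%N && (n%:R * alpha \is a Num.int) & (n <= size L)%N.
  (* Two of the [size L + 1] values of [k] share an index; subtracting their relations eliminates
     [t] and the element of [L], and leaves an integer multiple of [alpha]. *)
  pose f k := xchoose (hit k).
  have /injectivePn[k [k' neqk eqf]] : ~~ injectiveb f.
    by apply/negP => /injectiveP /leq_card; rewrite !card_ord ltnn.
  wlog ltk : k k' neqk eqf / (k < k')%N.
    move=> H; move: (neqk); rewrite neq_ltn => /orP[/H|]; first exact.
    by move=> lt; apply: (H k' k) => //; rewrite eq_sym.
  exists (k' - k)%N; last by have := ltn_ord k'; lia.
  rewrite subn_gt0 ltk natrB ?(ltnW ltk) //=.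
  have -> : (k'%:R - k%:R) * alpha =
      L`_(f k') - t + k'%:R * alpha - (L`_(f k) - t + k%:R * alpha).
    by rewrite eqf; ring.
  by apply: rpredB; apply: (xchooseP (hit _)).
pose P n := (0 < n)%N && (n%:R * alpha \is a Num.int).
have exP : exists n, P n by exists n0; apply/andP.
have [n /andP[n_gt0 nZ] n_min] := ex_minnP exP.
have n_le : (n <= size L)%N by apply: leq_trans n0_le; apply: n_min; apply/andP.
have [m nm] : exists m : nat, n%:R * alpha = m%:R.
  apply/natrP; rewrite natrEint nZ; rewrite mulr_ge0 ?ler0n ?ltW //.
have m_gt0 : (0 < m)%N.
  by rewrite -(ltr0n R) -nm mulr_gt0 ?ltr0n.
have m_lt : (m < n)%N.
  by rewrite -(ltr_nat R) -nm gtr_pMr ?ltr0n.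
(* [F (t - n%:R * alpha)] is evaluated by both sign rules, and [F t] is cancelled. *)
have par : odd n = odd m.
  have := F_natalpha n t; rewrite nm F_nat => /(mulIf Ft).
  rewrite -signr_odd -[RHS]signr_odd => /eqP.
  by case: (odd n); case: (odd m) => //; rewrite ?expr0 ?expr1 ?[1 == _]eq_sym
     eqNr oner_eq0.
have oddn : odd n.
  apply: contraT => evn; have evm : ~~ odd m by rewrite -par.
  have : P n./2.
    rewrite /P half_gt0; apply/andP; split; first by case: (n) n_gt0 evn => [|[]].
    have -> : n./2%:R * alpha = m./2%:R; last exact: rpred_nat.
    apply: (@mulfI _ 2%:R); first by rewrite pnatr_eq0.
    by rewrite mulrA -!natrM !mul2n !even_halfK.
  by move=> /n_min; lia.
by exists n, m; rewrite -par m_gt0.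
Qed.
End IntSign.

(** * Characteristic polynomials of Kronecker products *)

Section CharPoly.
Variable R : comNzRingType.

Lemma char_poly_conj n (A P Q : 'M[R]_n) :
  Q *m P = 1%:M -> char_poly (Q *m A *m P) = char_poly A.
Proof.
move=> QP; rewrite /char_poly.
have QPp : map_mx polyC Q *m map_mx polyC P = 1%:M by rewrite -map_mxM QP map_mx1.
have -> : char_poly_mx (Q *m A *m P) =
    map_mx polyC Q *m char_poly_mx A *m map_mx polyC P.
  rewrite /char_poly_mx mulmxBr mulmxBl !map_mxM /=.
  by rewrite mul_mx_scalar -scalemxAl QPp scalemx1.
by rewrite !det_mulmx mulrAC -det_mulmx QPp det1 mul1r.
Qed.

Lemma char_poly_diag n (D : 'rV[R]_n) :
  char_poly (diag_mx D) = \prod_(i < n) ('X - (D 0 i)%:P).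
Proof.
rewrite char_poly_trig ?diag_mx_is_trig //.
by apply: eq_bigr => i _; rewrite mxE eqxx mulr1n.
Qed.

Lemma tensmx11 m n : (1%:M : 'M[R]_m) *t (1%:M : 'M[R]_n) = 1%:M.
Proof.
apply/matrixP => i j; case: (mxtens_indexP i) => i1 i2.
case: (mxtens_indexP j) => j1 j2; rewrite tensmxE !mxE -natrM mulnb.
congr (nat_of_bool _)%:R; rewrite -(inj_eq (can_inj (@mxtens_unindexK m n))).
by rewrite !mxtens_indexK.
Qed.

Lemma tens_diag_mx m n (D : 'rV[R]_m) (E : 'rV[R]_n) :
  diag_mx D *t diag_mx E = diag_mx (D *t E).
Proof.
apply/matrixP => i j; case: (mxtens_indexP i) => i1 i2.
case: (mxtens_indexP j) => j1 j2; rewrite tensmxE !mxE !mxtens_indexK /=.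
rewrite mulrnAl mulrnAr -mulrnA mulnb [in RHS](can_eq (@mxtens_indexK m n)).
by rewrite !ord1 andbC.
Qed.

Lemma char_poly_tens_diag m n (D : 'rV[R]_m) (E : 'rV[R]_n) :
  char_poly (diag_mx D *t diag_mx E) =
    \prod_(i < m) \prod_(j < n) ('X - (D 0 i * E 0 j)%:P).
Proof.
rewrite tens_diag_mx char_poly_diag pair_big /=.
rewrite (reindex (@mxtens_index m n)) /=; last first.
  by exists (@mxtens_unindex m n) => i _; rewrite (mxtens_indexK, mxtens_unindexK).
by apply: eq_bigr => -[i j] _; rewrite mxE !mxtens_indexK !ord1.
Qed.

End CharPoly.

(** * Spectra of normal and Gram matrices *)

Section Normal.
Variable C : numClosedFieldType.
Local Open Scope sesquilinear_scope.

(** The Kronecker product of the two diagonalizing matrices diagonalizes [A *t B]; [s] and [t] are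
    the diagonals up to order. *)
Lemma char_poly_tens m n (A : 'M[C]_m) (B : 'M[C]_n) (s t : seq C) :
  A \is normalmx -> B \is normalmx ->
  char_poly A = \prod_(x <- s) ('X - x%:P) ->
  char_poly B = \prod_(y <- t) ('X - y%:P) ->
  char_poly (A *t B) = \prod_(x <- s) \prod_(y <- t) ('X - (x * y)%:P).
Proof.
move=> /orthomx_spectralP eqA /orthomx_spectralP eqB.
set U := spectralmx A in eqA; set V := spectralmx B in eqB.
set D := spectral_diag A in eqA; set E := spectral_diag B in eqB.
have [uU uV] : U \in unitmx /\ V \in unitmx by rewrite !spectral_unit.
rewrite eqA eqB -!tensmx_mul !char_poly_conj ?mulVmx //; last first.
  by rewrite tensmx_mul !mulVmx // tensmx11.
rewrite char_poly_tens_diag !char_poly_diag => eqs eqt.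
have ps : perm_eq s [seq D 0 i | i <- index_enum 'I_m].
  by apply: prod_XsubC_eq; rewrite -eqs big_map.
have pt : perm_eq t [seq E 0 i | i <- index_enum 'I_n].
  by apply: prod_XsubC_eq; rewrite -eqt big_map.
rewrite (perm_big _ ps) /= big_map; apply: eq_bigr => i _.
by rewrite (perm_big _ pt) /= big_map.
Qed.

Lemma gram_normal m n (M : 'M[C]_(m, n)) : M *m M ^t* \is normalmx.
Proof. by apply/normalmxP; rewrite trmx_mul map_mxM trmxCK. Qed.

(** After unitary diagonalization the two diagonals agree up to a permutation, which a permutation
    matrix, itself unitary, realizes by conjugation. *)
Lemma normal_unitarily_similar n (A B : 'M[C]_n) :
  A \is normalmx -> B \is normalmx -> char_poly A = char_poly B ->
  exists2 Q, Q \is unitarymx & B = Q *m A *m Q ^t*.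
Proof.
move=> /orthomx_spectralP eqA /orthomx_spectralP eqB.
have uU := spectral_unitarymx A; have uV := spectral_unitarymx B.
rewrite eqA eqB !char_poly_conj ?mulVmx ?spectral_unit // !char_poly_diag.
set U := spectralmx A in eqA uU *; set V := spectralmx B in eqB uV *.
set D := spectral_diag A in eqA *; set E := spectral_diag B in eqB *.
have prod_tuple (F : 'rV[C]_n) :
    \prod_(x <- [tuple F 0 i | i < n]) ('X - x%:P) = \prod_i ('X - (F 0 i)%:P).
  by rewrite big_tuple; apply: eq_bigr => i _; rewrite tnth_mktuple.
rewrite -!prod_tuple => /prod_XsubC_eq; rewrite perm_sym => /tuple_permP[s eqs].
have eqE : E = col_perm s D.
  apply/rowP => i; rewrite mxE.
  have /(congr1 (fun t => t`_i)) := eqs.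
  by rewrite -!tnth_nth !tnth_mktuple.
have diagE : diag_mx E = perm_mx s *m diag_mx D *m (perm_mx s)^t*.
  rewrite tr_perm_mx map_perm_mx -row_permE -col_permE.
  by apply/matrixP => i j; rewrite eqE !mxE (inj_eq perm_inj).
have uP : perm_mx s \is @unitarymx C n n.
  apply/unitarymxP; rewrite tr_perm_mx map_perm_mx -perm_mxM.
  by rewrite mulgV perm_mx1.
have VK : V ^t* ^t* = V by rewrite trmxCK.
exists (V ^t* *m perm_mx s *m U).
  by rewrite !mul_unitarymx // trmxC_unitary.
rewrite !trmx_mul !map_mxM VK /= diagE !invmx_unitary // !mulmxA.
by rewrite !mulmxtVK.
Qed.

(** Once [P] conjugates one Gram matrix into the other, [P *m M] and [N] have the same Gram matrix,
    so the quotient [invmx (P *m M) *m N] is unitary. *)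
Lemma eq_char_poly_gram n (M N : 'M[C]_n) : M \in unitmx ->
  char_poly (M *m M ^t*) = char_poly (N *m N ^t*) ->
  exists P Q : 'M[C]_n,
    [/\ P \is unitarymx, Q \is unitarymx & P *m M *m Q^T = N].
Proof.
move=> uM eqMN.
have [P uP eqN] := normal_unitarily_similar (gram_normal M) (gram_normal N) eqMN.
have uPM : P *m M \in unitmx by rewrite unitmx_mul unitarymx_unit.
exists P, (invmx (P *m M) *m N)^T; split=> //; last by rewrite trmxK mulKVmx.
rewrite trmx_unitary; apply/unitarymxP.
have eqK : N *m N ^t* = (P *m M) *m (P *m M) ^t*.
  by rewrite eqN trmx_mul map_mxM !mulmxA.
rewrite trmx_mul map_mxM mulmxA -(mulmxA _ N) eqK mulKmx //.
by rewrite -map_mxM -trmx_mul mulVmx // trmx1 map_mx1.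
Qed.

Lemma char_poly_gram_unitary n (M P Q : 'M[C]_n) :
  P \is unitarymx -> Q \is unitarymx ->
  char_poly ((P *m M *m Q^T) *m (P *m M *m Q^T) ^t*) = char_poly (M *m M ^t*).
Proof.
move=> uP uQ; have uQt : Q^T \is unitarymx by rewrite trmx_unitary.
rewrite !trmx_mul !map_mxM !mulmxA (mulmxtVK _ uQt) -(mulmxA P).
by rewrite char_poly_conj //; apply/unitarymxP.
Qed.

(** For an eigenvector [v], the squared norm of [v *m M] is [x] times that of [v], and both are
    positive. *)
Lemma gram_eigenvalue_gt0 n (M : 'M[C]_n) (s : seq C) : M \in unitmx ->
  char_poly (M *m M ^t*) = \prod_(x <- s) ('X - x%:P) ->
  {in s, forall x, 0 < x}.
Proof.
move=> uM eqs x xs.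
have /eigenvalueP[v /(congr1 (mulmx^~ (v ^t*))) eqv v0] :
    eigenvalue (M *m M ^t*) x.
  by rewrite eigenvalue_root_char eqs root_prod_XsubC.
have vM0 : v *m M != 0.
  by apply: contra v0 => /eqP vM; rewrite -(mulmxK uM v) vM mul0mx.
have := dotmx_is_dotmx vM0; rewrite dotmxE trmx_mul map_mxM !mulmxA.
rewrite -(mulmxA v) eqv -scalemxAl mxE -dotmxE.
by rewrite pmulr_lgt0 // dotmx_is_dotmx.
Qed.

End Normal.

(** * Multisets of exponents *)

Section Exponents.
Local Open Scope nat_scope.

(* In generating functions, [L] is [1 + x^2 + ... + x^(2 (d1 - 1))] and [Lb] is
   [(1 + x^d2) / (1 + x) * (1 + x + ... + x^(d1 - 1))]. *)
Lemma exponent_multisets_base d1 d2 : odd d1 -> odd d2 -> (d2 < d1)%N ->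
  exists L Lb : seq nat, [/\ size L = d1, size Lb = d1 &
    perm_eq (L ++ [seq k + d2 | k <- L]) (Lb ++ [seq k + d1 | k <- Lb])].
Proof.
move=> o1 o2 lt21.
(* The coefficient of x^k in (1 - x + ... + x^(d2 - 1)) (1 + x + ... + x^(d1 - 1)) is a sum of
   consecutive alternating signs. It is 1 for d2 <= k < d1, where all signs occur; elsewhere below
   d1 + d2 it is 1 for even k and 0 for odd k. *)
pose P k := (~~ odd k && (k < d1 + d2) || (d2 <= k < d1))%N.
pose L := [seq k <- iota 0 (d1 + d1) | ~~ odd k].
pose Lb := [seq k <- iota 0 (d1 + d1) | P k].
have memL k : (k \in L) = (~~ odd k && (k < d1 + d1))%N.
  by rewrite mem_filter mem_iota add0n.
have memLb k : (k \in Lb) = P k.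
  by rewrite mem_filter mem_iota add0n /P; apply/idP/idP; lia.
have mem_shift c (s : seq nat) k : (k \in [seq j + c | j <- s]) = (c <= k) && (k - c \in s).
  apply/mapP/andP => [[j js ->]|[ck ks]]; last by exists (k - c); rewrite ?subnK.
  by rewrite leq_addl addnK.
have uniq_shift c (s : seq nat) : uniq s -> uniq [seq j + c | j <- s].
  by move=> us; rewrite map_inj_uniq // => x y /addIn.
have uL : uniq L by rewrite filter_uniq ?iota_uniq.
have uLb : uniq Lb by rewrite filter_uniq ?iota_uniq.
have sL : size L = d1.
  rewrite size_filter; elim: (d1) => // n IHn.
  by rewrite addSn addnS -addn2 iotaD count_cat IHn /=; lia.
have pLLb : perm_eq (L ++ [seq k + d2 | k <- L]) (Lb ++ [seq k + d1 | k <- Lb]).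
  (* No exponent repeats on either side (on the left, [L] is even and its shift by the odd [d2] is
     odd), so comparing memberships suffices. *)
  apply: uniq_perm.
  - rewrite cat_uniq uL uniq_shift // andbT /=; apply/hasPn => k.
    by rewrite mem_shift !memL; lia.
  - rewrite cat_uniq uLb uniq_shift // andbT /=; apply/hasPn => k.
    by rewrite mem_shift !memLb /P; lia.
  - by move=> k; rewrite !mem_cat !mem_shift !memL !memLb /P; apply/idP/idP; lia.
exists L, Lb; split=> //; have := perm_size pLLb.
by rewrite !size_cat !size_map sL !addnn => /double_inj ->.
Qed.

Lemma exponent_multisets d d1 d2 :
  odd d -> odd d1 -> odd d2 -> (d2 < d1 <= d)%N ->
  exists L Lb : seq nat, [/\ size L = d, size Lb = d &
    perm_eq (L ++ [seq k + d2 | k <- L]) (Lb ++ [seq k + d1 | k <- Lb])].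
Proof.
move=> o o1 o2 /andP[lt21 le1].
have -> : d = (d1 + 2 * (d - d1)./2)%N by lia.
elim: (_./2) => [|n [L [Lb [sL sLb pLLb]]]].
  by rewrite muln0 addn0; apply: exponent_multisets_base.
(* Both sides of the identity grow by (1 + x^d1) (1 + x^d2), and both sizes by 2. *)
exists [:: 0, d1 & L], [:: 0, d2 & Lb]; split; rewrite /= ?sL ?sLb ?mulnS; try lia.
apply/seq.permP => p; have /seq.permP/(_ p) := pLLb.
rewrite !(count_cat, count_map) /= !count_cat /= !count_map !add0n (addnC d2 d1).
move: (count p L) (count p Lb) (count _ L) (count _ Lb) => x y z t.
by move: (p 0 : nat) (p d1 : nat) (p d2 : nat) (p (d1 + d2) : nat); lia.
Qed.

End Exponents.

(** * Squared Schmidt coefficients and local unitaries *)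

Section Schmidt.
Variable R : rcfType.
Local Open Scope complex_scope.

Lemma pos_complex_seq (s : seq R[i]) : {in s, forall z, 0 < z} ->
  exists2 t : seq R, {in t, forall x, 0 < x} & s = [seq x%:C | x <- t].
Proof.
move=> s_gt0; have zE z : z \in s -> (complex.Re z)%:C = z /\ 0 < complex.Re z.
  by move=> /s_gt0; case: z => x y; rewrite ltcE /= => /andP[/eqP ->].
exists [seq complex.Re z | z <- s].
  by move=> _ /mapP[z /zE[_ ?] ->].
rewrite -map_comp -[LHS]map_id; apply/eq_in_map => z /zE[zz _].
by rewrite /= zz.
Qed.

Lemma sq_schmidt_seq n (M : 'M[R[i]]_n) : M \in unitmx ->
  exists s : seq R, [/\ size s = n, {in s, forall x, 0 < x} &
    char_poly (M *m adjmx M) = \prod_(x <- s) ('X - x%:C%:P)].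
Proof.
move=> uM; have [s eqs] := closed_field_poly_normal (char_poly (M *m adjmx M)).
move: eqs; rewrite (monicP (char_poly_monic _)) scale1r => eqs.
have [t t_gt0 st] := pos_complex_seq (gram_eigenvalue_gt0 uM eqs).
exists t; split=> //; last by rewrite eqs st big_map.
have := size_char_poly (M *m adjmx M).
by rewrite eqs size_prod_XsubC st size_map => -[].
Qed.

(** Up to sign, the determinant is the constant coefficient of the characteristic polynomial; if it
    vanished, 0 would be among the positive roots. *)
Lemma unitmx_gram n (M : 'M[R[i]]_n) (s : seq R) :
  {in s, forall x, 0 < x} ->
  char_poly (M *m adjmx M) = \prod_(x <- s) ('X - x%:C%:P) -> M \in unitmx.
Proof.
move=> s_gt0 eqs; suff : M *m adjmx M \in unitmx by rewrite unitmx_mul => /andP[].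
rewrite unitmxE unitfE; apply/eqP => det0.
have : root (char_poly (M *m adjmx M)) 0.
  by rewrite /root horner_coef0 char_poly_det det0 mulr0.
rewrite eqs -(big_map (real_complex R) predT (fun z => 'X - z%:P)) root_prod_XsubC.
by move=> /mapP[x /s_gt0 x_gt0 /(congr1 (@complex.Re R)) /= x0]; rewrite -x0 ltxx in x_gt0.
Qed.

(** The Gram matrix of a Kronecker product is the Kronecker product of the Gram matrices, so the
    spectra multiply. *)
Lemma char_poly_gram_tens n (mu : 'M[R[i]]_2) (lam : 'M[R[i]]_n) (p q : R)
    (s : seq R) :
  sq_schmidt_coeffs2 mu p q ->
  char_poly (lam *m adjmx lam) = \prod_(x <- s) ('X - x%:C%:P) ->
  char_poly (tens_state mu lam *m adjmx (tens_state mu lam)) =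
    \prod_(x <- [seq p * x | x <- s] ++ [seq q * x | x <- s]) ('X - x%:C%:P).
Proof.
rewrite /sq_schmidt_coeffs2 => eqmu eqlam.
have -> : adjmx (tens_state mu lam) = adjmx mu *t adjmx lam.
  by rewrite /adjmx /tens_state trmx_tens map_mxT.
rewrite /tens_state tensmx_mul.
rewrite (@char_poly_tens _ _ _ _ _ [:: p%:C; q%:C] [seq x%:C | x <- s]).
- rewrite big_cons big_seq1 big_cat !big_map.
  by congr (_ * _); apply: eq_bigr => x _; rewrite [(_ * x)%:C]rmorphM.
- exact: (gram_normal mu).
- exact: (gram_normal lam).
- by rewrite eqmu big_cons big_seq1.
- by rewrite eqlam big_map.
Qed.

Lemma exists_state n (s : seq R) : size s = n -> {in s, forall x, 0 < x} ->
  \sum_(x <- s) x = 1 ->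
  exists lam : 'M[R[i]]_n, [/\ is_state lam, schmidt_rank lam = n &
    char_poly (lam *m adjmx lam) = \prod_(x <- s) ('X - x%:C%:P)].
Proof.
move=> <- s_gt0 sum_s.
(* The state is taken in Schmidt form, with the square roots of [s] as Schmidt coefficients. *)
pose D : 'rV[R[i]]_(size s) := \row_i (Num.sqrt s`_i)%:C.
have sqD i : D 0 i * conjc (D 0 i) = (s`_i)%:C.
  rewrite mxE conjc_real -rmorphM /= -expr2 sqr_sqrtr //.
  by rewrite ltW // s_gt0 // mem_nth.
have eqs : char_poly (diag_mx D *m adjmx (diag_mx D)) =
    \prod_(x <- s) ('X - x%:C%:P).
  rewrite /adjmx tr_diag_mx map_diag_mx mulmx_diag char_poly_diag (big_nth 0).
  rewrite big_mkord; apply: eq_bigr => i _; rewrite mxE [X in _ * X]mxE.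
  by rewrite sqD.
exists (diag_mx D); split=> //; last first.
  by apply: mxrank_unit; apply: unitmx_gram eqs.
rewrite /is_state (eq_bigr (fun i : 'I_(size s) => (s`_i)%:C)) => [|i _].
  by rewrite -raddf_sum; move: sum_s; rewrite (big_nth 0) big_mkord => ->.
rewrite (bigD1 i) //= big1 => [|j neq].
  by rewrite addr0 !mxE eqxx mulr1n -sqD mxE.
by rewrite mxE eq_sym (negPf neq) mulr0n mul0r.
Qed.

Lemma local_unitary_of_char_poly n (psi phi : 'M[R[i]]_n) :
  psi \in unitmx ->
  char_poly (psi *m adjmx psi) = char_poly (phi *m adjmx phi) ->
  local_unitary_maps psi phi.
Proof.
move=> upsi /(eq_char_poly_gram upsi)[U [V [/unitarymxP uU /unitarymxP uV eqUV]]].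
by exists U, V.
Qed.

Lemma char_poly_of_local_unitary n (psi phi : 'M[R[i]]_n) :
  local_unitary_maps psi phi ->
  char_poly (phi *m adjmx phi) = char_poly (psi *m adjmx psi).
Proof.
move=> [U [V [/unitarymxP uU [/unitarymxP uV <-]]]].
exact: char_poly_gram_unitary.
Qed.

End Schmidt.

(** * The two implications *)

Section Transformations.
Variables (R : realType) (d : nat) (mu mub : 'M[R[i]]_2) (a ab : R).
Hypotheses (a_gt0 : 0 < a) (a_lt1 : a < 1) (ab_gt0 : 0 < ab) (ab_lt_a : ab < a).
Hypothesis odd_d : odd d.
Hypothesis mu_coeffs : sq_schmidt_coeffs2 mu (1 / (1 + a)) (a / (1 + a)).
Hypothesis mub_coeffs : sq_schmidt_coeffs2 mub (1 / (1 + ab)) (ab / (1 + ab)).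

Lemma ratio_of_local_unitary (lam lamb : 'M[R[i]]_d) :
  schmidt_rank lam = d -> schmidt_rank lamb = d ->
  local_unitary_maps (tens_state mu lam) (tens_state mub lamb) ->
  exists d1 d2 : nat,
    [/\ odd d1, odd d2, (1 <= d2 < d1)%N, (d1 <= d)%N &
        ab = a `^ (d1%:R / d2%:R)].
Proof.
move=> rk rkb /char_poly_of_local_unitary.
have [|L [sL L_gt0 eqL]] := @sq_schmidt_seq _ _ lam.
  by rewrite -row_full_unit; apply/eqP.
have [|Lb [sLb Lb_gt0 eqLb]] := @sq_schmidt_seq _ _ lamb.
  by rewrite -row_full_unit; apply/eqP.
rewrite (char_poly_gram_tens mu_coeffs eqL) (char_poly_gram_tens mub_coeffs eqLb).
rewrite -!(big_map (real_complex R) predT (fun z => 'X - z%:P)) => /prod_XsubC_eq.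
have /perm_map_inj inj_re : injective (real_complex R) by move=> x y [].
move=> /inj_re; rewrite perm_sym => pL.
have lnab_lt0 : ln ab < 0 by rewrite ln_lt0 // ab_gt0 (lt_trans ab_lt_a).
have lnab_neq0 : ln ab != 0 by rewrite lt_eqF.
have lna_lt0 : ln a < 0 by rewrite ln_lt0 // a_gt0.
(* Absorbing the factor 1 / (1 + c) into [h] leaves only the shift [ln c / ln ab]: this is [alpha]
   for [c = a] and 1 for [c = ab]. *)
pose h c (x : R) := ln (1 / (1 + c) * x) / ln ab.
have shift c (s : seq R) : 0 < c -> {in s, forall x, 0 < x} ->
    [seq ln x / ln ab |
       x <- [seq 1 / (1 + c) * x | x <- s] ++ [seq c / (1 + c) * x | x <- s]] =
    [seq h c x | x <- s] ++ [seq x + ln c / ln ab | x <- [seq h c x | x <- s]].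
  move=> c_gt0 s_gt0; rewrite map_cat -!map_comp; congr (_ ++ _).
  apply/eq_in_map => x /s_gt0 x_gt0 /=; rewrite /h -mulrDl -lnM ?posrE //.
  - by congr (ln _ / _); ring.
  - by rewrite mulr_gt0 // divr_gt0 // addr_gt0.
have := perm_map (fun x => ln x / ln ab) pL; rewrite !shift // divff //.
move=> /odd_ratio_of_perm[||n [m [on om /andP[m_gt0 lt_mn] n_le]]].
(* Both logarithms are negative, so the quotient is positive, and [ab < a] puts it below 1. *)
- by rewrite -mulrNN -invrN; apply/andP; split;
    [rewrite divr_gt0 ?oppr_gt0 | rewrite ltr_pdivrMr ?oppr_gt0 // mul1r ltrN2 ltr_ln].
- by rewrite size_map sL.
rewrite size_map sL in n_le.
have m0 : (m%:R : R) != 0 by rewrite pnatr_eq0 -lt0n.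
move=> eq_nm; exists n, m; split=> //; first by rewrite m_gt0.
rewrite /powR gt_eqF //; have -> : n%:R / m%:R * ln a = ln ab; last by rewrite lnK.
by apply: (mulIf m0); rewrite mulrAC divfK // -[in RHS]eq_nm; field.
Qed.

Lemma local_unitary_of_ratio (d1 d2 : nat) :
  odd d1 -> odd d2 -> (1 <= d2 < d1)%N -> (d1 <= d)%N ->
  ab = a `^ (d1%:R / d2%:R) ->
  exists lam lamb : 'M[R[i]]_d,
    [/\ is_state lam, is_state lamb,
        schmidt_rank lam = d, schmidt_rank lamb = d &
        local_unitary_maps (tens_state mu lam) (tens_state mub lamb)].
Proof.
move=> o1 o2 /andP[d2_gt0 lt21] le1 eqab.
have lt21d : (d2 < d1 <= d)%N by rewrite lt21.
have [L [Lb [sL sLb pL]]] := exponent_multisets odd_d o1 o2 lt21d.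
(* This common root gives [b ^+ d2 = a] and [b ^+ d1 = ab], so exponents in [L] and [Lb] become
   powers of [b]. *)
pose b := a `^ (d2%:R^-1).
have b_gt0 : 0 < b by rewrite powR_gt0.
have bX n : b ^+ n = a `^ (n%:R / d2%:R).
  by rewrite -powR_mulrn ?ltW // -powRrM mulrC.
have bd2 : b ^+ d2 = a.
  by rewrite bX divff ?powRr1 ?ltW // pnatr_eq0 -lt0n.
have bd1 : b ^+ d1 = ab by rewrite bX.
pose S (l : seq nat) : R := \sum_(k <- l) b ^+ k.
have S_gt0 l : size l = d -> 0 < S l.
  case: l => [s0|k l _]; first by move: odd_d; rewrite -s0.
  rewrite /S big_cons ltr_pwDl ?exprn_gt0 // sumr_ge0 // => j _.
  by rewrite exprn_ge0 // ltW.
have S_shift l e : S (l ++ [seq (k + e)%N | k <- l]) = S l * (1 + b ^+ e).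
  rewrite /S big_cat big_map mulrDr mulr1 mulr_suml; congr (_ + _).
  by apply: eq_bigr => k _; rewrite exprD.
(* The generating function identity is evaluated at [b]: the normalizations of the two product
   states coincide. *)
have eqS : S L * (1 + a) = S Lb * (1 + ab).
  by rewrite -bd2 -bd1 -!S_shift /S; apply: perm_big.
have state l : size l = d -> exists lam : 'M[R[i]]_d,
    [/\ is_state lam, schmidt_rank lam = d & char_poly (lam *m adjmx lam) =
      \prod_(x <- [seq b ^+ k / S l | k <- l]) ('X - (x%:C)%C%:P)].
  move=> sl; apply: exists_state; first by rewrite size_map.
    by move=> _ /mapP[k _ ->]; rewrite divr_gt0 ?exprn_gt0 ?S_gt0.
  by rewrite big_map -mulr_suml divff // gt_eqF // S_gt0.
have [lam [st rk eqlam]] := state _ sL; have [lamb [stb rkb eqlamb]] := state _ sLb.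
exists lam, lamb; split=> //.
(* Over the common denominator [S L * (1 + a)], both product spectra are images of exponent lists
   under one map, so the permutation [pL] carries over to them. *)
have spec l e c : S l * (1 + c) = S L * (1 + a) -> size l = d -> 0 < c ->
    b ^+ e = c ->
    [seq 1 / (1 + c) * x | x <- [seq b ^+ k / S l | k <- l]] ++
    [seq c / (1 + c) * x | x <- [seq b ^+ k / S l | k <- l]] =
    [seq b ^+ k / (S L * (1 + a)) | k <- l ++ [seq (k + e)%N | k <- l]].
  move=> <- sl c_gt0 bc; have Sl0 : S l != 0 by rewrite gt_eqF ?S_gt0.
  have c0 : 1 + c != 0 by rewrite gt_eqF ?addr_gt0.
  rewrite map_cat -!map_comp; congr (_ ++ _); apply: eq_map => k /=.
    by field; rewrite c0.
  by rewrite exprD bc; field; rewrite c0.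
have eqmu := char_poly_gram_tens mu_coeffs eqlam.
apply: local_unitary_of_char_poly.
  apply: unitmx_gram eqmu => x; rewrite (spec L d2) // => /mapP[k _ ->].
  by rewrite divr_gt0 ?exprn_gt0 // mulr_gt0 ?S_gt0 // addr_gt0.
rewrite eqmu (char_poly_gram_tens mub_coeffs eqlamb) (spec L d2) // (spec Lb d1) //.
by apply: perm_big; apply: perm_map.
Qed.

End Transformations.

Theorem theorem6 (R : realType) (d : nat) (mu mub : 'M[R[i]]_2) (a ab : R) :
  0 < a < 1 -> 0 < ab < 1 -> ab < a ->
  odd d -> (3 <= d)%N ->
  is_state mu -> is_state mub ->
  sq_schmidt_coeffs2 mu (1 / (1 + a)) (a / (1 + a)) ->
  sq_schmidt_coeffs2 mub (1 / (1 + ab)) (ab / (1 + ab)) ->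
  (exists lam lamb : 'M[R[i]]_d,
      [/\ is_state lam, is_state lamb,
          schmidt_rank lam = d, schmidt_rank lamb = d &
          local_unitary_maps (tens_state mu lam) (tens_state mub lamb)])
  <->
  (exists d1 d2 : nat,
      [/\ odd d1, odd d2, (1 <= d2 < d1)%N, (d1 <= d)%N &
          ab = a `^ (d1%:R / d2%:R)]).
Proof.
move=> /andP[a_gt0 a_lt1] /andP[ab_gt0 _] ab_lt_a odd_d _ _ _ mu_coeffs mub_coeffs.
split=> [[lam [lamb [_ _ rk rkb lu]]]|[d1 [d2 [o1 o2 lt21 le1 eqab]]]].
  exact: (ratio_of_local_unitary a_gt0 a_lt1 ab_gt0 ab_lt_a odd_d mu_coeffs
    mub_coeffs rk rkb lu).
exact: (local_unitary_of_ratio a_gt0 ab_gt0 odd_d mu_coeffs mub_coeffs o1 o2 lt21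
  le1 eqab).
Qed.
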